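(* Let $X$ be a Banach space whose norm $\|\cdot\|$ is Kadec, and let $B$ denote the closed unit ball of $X$. Then there exists a strategy $s$ for the player $\Omega$ in the fragmenting game on $(B, \text{weak})$ such that, for every $s$-play $p = (A_i, B_i)_{i \geq 1}$, either $\bigcap_{i \geq 1} B_i = \emptyset$ or $\lim_{i \to \infty} \text{norm-diam}(B_i) = 0$.
   Context: The norm of a Banach space $X$ is called Kadec if the norm topology and the weak topology coincide on the unit sphere $\{x \in X : \|x\| = 1\}$. $(B,\text{weak})$ is the closed unit ball $B = \{x \in X : \|x\| \le 1\}$ with the topology induced by the weak topology of $X$. For a set $A \subset X$, norm-diam$(A)$ is its diameter in the metric given by the norm. The fragmenting game on a topological space $Y$: two players $\Sigma$ and $\Omega$ alternately select subsets of $Y$. $\Sigma$ starts by choosing a nonempty subset $A_1$ of $Y$; then $\Omega$ chooses a nonempty relatively open subset $B_1$ of $A_1$. In general, once the nonempty set $B_n$ has been chosen by $\Omega$, the player $\Sigma$ selects an arbitrary nonempty set $A_{n+1} \subset B_n$, and $\Omega$ then chooses a nonempty relatively open subset $B_{n+1}$ of $A_{n+1}$. The resulting sequence $A_1 \supset B_1 \supset \cdots \supset A_n \supset B_n \supset \cdots$ is called a play and is denoted $p = (A_i, B_i)_{i \ge 1}$; its $n$th partial play is $p_n = (A_1, B_1, \ldots, B_{n-1}, A_n)$ (with $p_1 = (A_1)$). A strategy $s$ for $\Omega$ is a sequence of mappings $s = \{s_n\}_{n \ge 1}$ defined inductively: $s_1$ assigns to each nonempty subset $A_1$ of $Y$ a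 nonempty relatively open subset $B_1 = s_1(A_1)$ of $A_1$; the domain of $s_{n+1}$ consists of all partial plays $(A_1, B_1, \ldots, A_n, B_n, A_{n+1})$ such that, for every $i \le n$, $(A_1, B_1, \ldots, A_i)$ is in the domain of $s_i$ and $B_i = s_i(A_1, B_1, \ldots, A_i)$, and $A_{n+1}$ is an arbitrary nonempty subset of $B_n$; to each such element $s_{n+1}$ assigns a nonempty relatively open subset $B_{n+1}$ of $A_{n+1}$. A play $p = (A_i, B_i)_{i \ge 1}$ is called an $s$-play if $B_i = s_i(p_i)$ for each $i \ge 1$. *)

(* Defs.v *)
From HB Require Import structures.
From mathcomp Require Import all_boot all_order all_algebra.
From mathcomp Require Import all_classical all_reals all_analysis.

Set Implicit Arguments.
Unset Strict Implicit.
Unset Printing Implicit Defensive.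

Import Order.TTheory GRing.Theory Num.Theory.
Import numFieldNormedType.Exports.

Local Open Scope classical_set_scope.
Local Open Scope ring_scope.

Definition topological_dual (R : realType) (X : normedModType R) :=
  {f : {scalar X} | continuous (f : X -> R)}.

Definition weak (R : realType) (X : normedModType R) : topologicalType :=
  sup_topology (fun f : topological_dual X =>
    Topological.class (initial_topology (sval f : X -> R))).

Definition unit_sphere (R : realType) (X : normedModType R) : set X :=
  [set x | `|x| = 1].

Arguments unit_sphere {R} X.

Definition unit_ball (R : realType) (X : normedModType R) : set X :=
  [set x | `|x| <= 1].

Arguments unit_ball {R} X.

(* The two sides carry the subtype topologies that the unit sphere inherits
   from X and from weak X. *)
Definition kadec (R : realType) (X : normedModType R) : Prop :=
  @open (set_type (unit_sphere X : set X)) =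
  @open (set_type (unit_sphere X : set (weak X))).

Definition weak_ball (R : realType) (X : normedModType R) : topologicalType :=
  set_type (unit_ball X : set (weak X)).

(* As ereal_sup set0 = -oo, this is the usual diameter for nonempty A only. *)
Definition norm_diam (R : realType) (X : normedModType R) (A : set X) : \bar R :=
  ereal_sup [set (`|x - y|)%:E | x in A & y in A].

Section FragmentingGame.
Variable Y : topologicalType.

Definition nonempty_relopen (A B : set Y) : Prop :=
  B !=set0 /\ exists2 U : set Y, open U & B = A `&` U.

(* s h A is the answer of Omega to the partial play
   (A_1, B_1, ..., A_n, B_n, A_(n+1)), where h is the sequence of the pairs
   (A_i, B_i) for i <= n and A = A_(n+1). A single function on sequences of
   all lengths represents the mappings s_1, s_2, ...; it is total, its values
   outside the domains described by strategy_dom being irrelevant. *)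
Definition strategy_map := seq (set Y * set Y) -> set Y -> set Y.

Inductive strategy_dom (s : strategy_map) :
    seq (set Y * set Y) -> set Y -> Prop :=
| strategy_dom1 A : A !=set0 -> strategy_dom s [::] A
| strategy_domS h A A' : strategy_dom s h A ->
    A' !=set0 -> A' `<=` s h A -> strategy_dom s (rcons h (A, s h A)) A'.

Definition is_strategy (s : strategy_map) : Prop :=
  forall h A, strategy_dom s h A -> nonempty_relopen A (s h A).

(* Plays are indexed from 0: A i and B i are A_(i+1) and B_(i+1). *)
Definition is_play (A B : nat -> set Y) : Prop :=
  [/\ forall i, A i !=set0,
      forall i, nonempty_relopen (A i) (B i) &
      forall i, A i.+1 `<=` B i].

Definition is_s_play (s : strategy_map) (A B : nat -> set Y) : Prop :=
  is_play A B /\ forall i, B i = s (mkseq (fun j => (A j, B j)) i) (A i).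

End FragmentingGame.

(* Main.v *)
Require Import Defs.
From HB Require Import structures.
From mathcomp Require Import all_boot all_order all_algebra.
From mathcomp Require Import all_classical all_reals all_analysis.
From mathcomp Require Import lra.
Import Order.TTheory GRing.Theory Num.Theory.
Import numFieldNormedType.Exports.
Local Open Scope classical_set_scope.
Local Open Scope ring_scope.

(** The Kadec property yields two facts about a point x and the weak topology.
    - [kadec_norm_lsc]: the norm is weakly lower semicontinuous, so that
      {y | c < |y|} is weakly open.
    - [kadec_shell]: points that are weakly close to x and whose norm is close
      to the norm of x are close to x in norm.

    Given A_n, the player Omega considers the slices of A_n: the nonempty
    relatively open subsets that consist of points whose norms are within
    1/n of the supremum of the norm on A_n.  There are some, by lower
    semicontinuity.  Among them Omega chooses one, B_n, whose diameter is
    minimal up to 1/n.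

    This strategy wins although Omega does not know which point will survive.
    Suppose that x lies in every B_n, and let V be a weakly open set containing
    x on which the shell property holds for some e and d.  All norms on B_n are
    within 1/n of |x|, so for 1/n < d the points of V in B_n lie in the ball of
    radius e around x.  They form a slice of A_n which is nonempty, as it
    contains x, and which has diameter at most 2e.  Hence the near-minimality
    of B_n forces the diameter of B_n to be at most 2e + 1/n.

    Weak neighbourhoods are handled through weakly continuous seminorms, which
    give a base of the weak topology ([weak_nbhs_seminorm]) and control at once
    all the multiples of a vector. *)

(** * Weakly continuous seminorms *)

Section WeakSeminorms.
Context {R : realType} {X : normedModType R}.
Implicit Types (p q : X -> R) (x y z : X).

Definition weak_seminorm p : Prop :=
  [/\ forall a y, p (a *: y) = `|a| * p y,
      forall y z, p (y + z) <= p y + p z &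
      forall x e, 0 < e -> nbhs (x : weak X) [set y : X | p (y - x) < e]].

Lemma weak_seminorm_ge0 p y : weak_seminorm p -> 0 <= p y.
Proof.
move=> [pZ pD _]; have p0 : p 0 = 0 by rewrite -(scale0r 0) pZ normr0 mul0r.
have := pD y (- y); rewrite subrr p0 -scaleN1r pZ normrN normr1 mul1r; lra.
Qed.

(* The neighbourhood filters of the weak topology are named explicitly below:
   from x : X, inference would select those of the norm topology. *)
Lemma weak_seminorm0 : weak_seminorm (fun=> 0).
Proof.
split=> [a y|y z|x e e0]; rewrite ?mulr0 ?addr0 //.
by apply: (@filterS _ (nbhs (x : weak X)) _ setT); [|exact: filterT].
Qed.

Lemma weak_seminorm_max p q : weak_seminorm p -> weak_seminorm q ->
  weak_seminorm (fun y => Num.max (p y) (q y)).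
Proof.
move=> [pZ pD pn] [qZ qD qn]; split=> [a y|y z|x e e0].
- by rewrite pZ qZ maxr_pMr.
- rewrite ge_max; apply/andP; split.
    by apply: le_trans (pD y z) _; rewrite lerD // le_max lexx ?orbT.
  by apply: le_trans (qD y z) _; rewrite lerD // le_max lexx ?orbT.
- have F : Filter (nbhs (x : weak X)) by exact: nbhs_filter.
  apply: filterS (filterI (pn x e e0) (qn x e e0)) => y [/= py qy].
  by rewrite gt_max py qy.
Qed.

Lemma weak_seminormZ c p : 0 <= c -> weak_seminorm p ->
  weak_seminorm (fun y => c * p y).
Proof.
move=> c0 wp; have [pZ pD pn] := wp; split=> [a y|y z|x e e0].
- by rewrite pZ mulrCA.
- by rewrite -mulrDr ler_wpM2l.
- have F : Filter (nbhs (x : weak X)) by exact: nbhs_filter.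
  have c1 : 0 < c + 1 by lra.
  apply: filterS (pn x _ (divr_gt0 e0 c1)) => y /=.
  rewrite ltr_pdivlMr // => h; apply: le_lt_trans h.
  have := weak_seminorm_ge0 p (y - x) wp; nra.
Qed.

Lemma weak_seminorm_dual (f : topological_dual X) :
  weak_seminorm (fun y => `|sval f y|).
Proof.
split=> [a y|y z|x e e0].
- by rewrite linearZ normrM.
- by rewrite linearD ler_normD.
- have /cvg_sup : nbhs (x : weak X) --> (x : weak X) by apply: cvg_id.
  move=> /(_ f) cf.
  pose I := [set t : R | `|t - sval f x| < e].
  have nI : nbhs (sval f x) I by exists e => // t; rewrite /I /= distrC.
  have -> : [set y : X | `|sval f (y - x)| < e] = sval f @^-1` I.
    by apply/funext => y; rewrite /I /= linearB.
  by apply: cf; exact: (@initial_continuous _ _ (sval f : X -> R) x _ nI).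
Qed.

(** Local convexity of the weak topology: the unit balls around x of the weakly
    continuous seminorms form a filter, as these seminorms are stable under
    maxima, and the multiples of the |f| make this filter finer than the
    neighbourhoods of x for each of the initial topologies whose supremum is
    the weak topology. *)
Lemma weak_nbhs_seminorm x (V : set X) : nbhs (x : weak X) V ->
  exists2 p, weak_seminorm p & forall y, p (y - x) < 1 -> V y.
Proof.
pose F := filter_from weak_seminorm (fun p => [set y | p (y - x) < 1]).
have FF : Filter F.
  apply: filter_from_filter; first by exists (fun=> 0); exact: weak_seminorm0.
  move=> p q wp wq; exists (fun y => Num.max (p y) (q y)).
    exact: weak_seminorm_max.
  by move=> y /=; rewrite gt_max => /andP.
suff : F --> (x : weak X) by move=> /[apply] -[p wp pV]; exists p.
apply/cvg_sup => f U [_ [[A oA <-] /= Afx] AU].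
have [e /= e0 eA] : nbhs (sval f x) A by exact: open_nbhs_nbhs.
exists (fun y => e^-1 * `|sval f y|).
  by apply: weak_seminormZ; [rewrite invr_ge0 ltW|exact: weak_seminorm_dual].
move=> y /=; rewrite mulrC ltr_pdivrMr // mul1r linearB => h.
by apply/AU/eA; rewrite /= distrC.
Qed.

End WeakSeminorms.

(** * Consequences of the Kadec property *)

Section KadecNorm.
Context {R : realType} {X : normedModType R} (hX : kadec X).
Implicit Types (x y z : X).

(** The Kadec property, stated on the unit sphere, passes to the sphere through
    x by scaling. *)
Lemma kadec_sphere x e : 0 < e -> exists2 p, weak_seminorm p &
  forall y, `|y| = `|x| -> p (y - x) < 1 -> `|y - x| < e.
Proof.
move=> e0; have [->|x0] := eqVneq x 0.
  exists (fun=> 0); first exact: weak_seminorm0.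
  by move=> y; rewrite normr0 => /normr0_eq0 ->; rewrite subrr normr0.
have r0 : 0 < `|x| by rewrite normr_gt0.
pose sph z := `|x|^-1 *: z.
have sphE z : `|z| = `|x| -> `|sph z| = 1.
  by move=> zx; rewrite normrZ normfV normr_id zx mulVf // gt_eqF.
pose O := [set y : X | `|y - sph x| < `|x|^-1 * e].
have oO : open O.
  have -> : O = ball (sph x) (`|x|^-1 * e).
    by apply/funext => y; rewrite -ball_normE /= /O /= distrC.
  exact: ball_open.
pose U : set (set_type (unit_sphere X : set X)) := set_val @^-1` O.
have : @open (set_type (unit_sphere X : set X)) U by exists O.
rewrite hX => -[W oW WU].
have inS z (zx : `|z| = `|x|) : sph z \in (unit_sphere X : set X).
  by apply/mem_set; exact: sphE.
have WO z : `|z| = `|x| -> W (sph z) <-> O (sph z).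
  move=> zx; pose v : set_type (unit_sphere X : set X) :=
    exist (fun u => u \in (unit_sphere X : set X)) _ (inS z zx).
  change (U v) with (O (sph z)).
  have -> : W (sph z) = U v by rewrite -WU.
  by [].
have Wx : nbhs (sph x : weak X) W.
  apply: (@open_nbhs_nbhs (weak X)); split => //; apply/WO => //.
  by rewrite /O /= subrr normr0 mulr_gt0 // invr_gt0.
have [p wp pW] := weak_nbhs_seminorm _ _ Wx.
have [pZ _ _] := wp.
have sphB y : sph y - sph x = `|x|^-1 *: (y - x) by rewrite scalerBr.
exists (fun y => `|x|^-1 * p y).
  by apply: weak_seminormZ => //; rewrite invr_ge0 ltW.
move=> y yx pyx.
have : O (sph y).
  by apply/WO => //; apply: pW; rewrite sphB pZ normfV normr_id.
by rewrite /O /= sphB normrZ normfV normr_id ltr_pM2l ?invr_gt0.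
Qed.

(** Suppose that y is weakly close to x while |y| <= c < |x|.  On the line from
    x through y the norm is below |x| at y and at least |x| far beyond y, so it
    takes the value |x| at some z = x + t (y - x) with t >= 1.  Since |y - x|
    is at least |x| - c, such a t is bounded by T = 2 |x| / (|x| - c), whatever
    y is; so z is weakly close to x too, and it lies on the sphere through x.
    By the Kadec property z is close to x in norm, although
    |z - x| >= |y - x| >= |x| - c. *)
Lemma kadec_norm_lsc x c : c < `|x| ->
  nbhs (x : weak X) [set y : X | c < `|y|].
Proof.
move=> cx.
have F : Filter (nbhs (x : weak X)) by exact: nbhs_filter.
have [c0|c0] := ltP c 0.
  apply: (@filterS _ (nbhs (x : weak X)) _ setT); last exact: filterT.
  by move=> y _ /=; exact: lt_le_trans c0 _.
have e0 : 0 < `|x| - c by lra.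
have [p wp pK] := kadec_sphere x _ e0.
have [pZ _ pn] := wp.
have r0 : 0 < `|x| by lra.
pose T := 2 * `|x| / (`|x| - c).
have T1 : 1 <= T by rewrite /T ler_pdivlMr //; lra.
have T0 : 0 < T by lra.
apply: filterS (pn x T^-1 _); last by rewrite invr_gt0.
move=> y /= pyx; rewrite ltNge; apply/negP => yc.
have yx : `|x| - c <= `|y - x|.
  by have := ler_normB y (y - x); rewrite subKr; lra.
pose g t := `|x + t *: (y - x)|.
have cg : {within `[1, T], continuous g}.
  apply: continuous_subspaceT => t; apply: cvg_norm.
  apply: cvgD; first exact: cvg_cst.
  by apply: cvgZr_tmp; exact: cvg_id.
have g1 : g 1 <= `|x| by rewrite /g scale1r addrC subrK; lra.
have gT : `|x| <= g T.
  have := ler_normB (x + T *: (y - x)) x; rewrite -/(g T) [x + _]addrC addrK.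
  rewrite normrZ ger0_norm; last by lra.
  have : T * (`|x| - c) <= T * `|y - x| by rewrite ler_pM2l.
  rewrite /T divfK; last by rewrite gt_eqF.
  by lra.
have [t /itvP tI gt] : exists2 t, t \in `[1, T] & g t = `|x|.
  by apply: IVT => //; rewrite ge_min le_max g1 gT orbT.
have t1 : 1 <= t by rewrite tI.
have zE : (x + t *: (y - x)) - x = t *: (y - x) by rewrite addrC addKr.
have := pK _ gt; rewrite zE pZ normrZ ger0_norm; last by lra.
have pt : t * p (y - x) < 1.
  have tT : t <= T by rewrite tI.
  apply: (@le_lt_trans _ _ (T * p (y - x))).
    by rewrite ler_wpM2r // (weak_seminorm_ge0 p).
  by rewrite -ltr_pdivlMl // mulr1.
by move=> /(_ pt); nra.
Qed.

(** The radial projection z of y to the sphere through x is close to y in norm,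
    because their distance is the difference of |y| and |x|; and z is weakly
    close to x if y is.  So the Kadec property applies to z. *)
Lemma kadec_shell x e : 0 < e -> exists2 d, 0 < d &
  nbhs (x : weak X) [set y : X | `| `|y| - `|x| | < d -> `|y - x| < e].
Proof.
move=> e0.
have [->|x0] := eqVneq x 0.
  exists e => //; apply: (@filterS _ (nbhs (0 : weak X)) _ setT).
    by move=> y _ /=; rewrite normr0 !subr0 normr_id.
  exact: (@filterT _ _ (@nbhs_filter (weak X) 0)).
have r0 : 0 < `|x| by rewrite normr_gt0.
have e20 : 0 < e / 2 by lra.
have [p wp pK] := kadec_sphere x _ e20.
have [pZ pD pn] := wp.
have px0 := weak_seminorm_ge0 p x wp.
pose M := p x + 1.
have M0 : 0 < M by rewrite /M; lra.
(* The three bounds on the difference of |y| and |x| ensure respectively that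
   |y - z| < e / 2, that |y| stays above |x| / 2, and that p (z - y) <= 1 / 2,
   where M bounds p on the weak neighbourhood from which y is taken. *)
exists (Num.min (e / 2) (Num.min (`|x| / 2) (`|x| / (4 * M)))).
  by rewrite !lt_min e20 !divr_gt0 //; lra.
have h20 : (0 : R) < 1 / 2 by lra.
have F : Filter (nbhs (x : weak X)) by exact: nbhs_filter.
apply: filterS (pn x _ h20) => y /= pyx; rewrite !lt_min => /and3P[d1 d2 d3].
have ry : `|x| / 2 < `|y| by move: d2; rewrite ltr_norml => /andP[]; lra.
have y0 : 0 < `|y| by lra.
pose z := (`|x| / `|y|) *: y.
have zN : `|z| = `|x|.
  by rewrite normrZ normrM normfV !normr_id divfK // gt_eqF.
have zyE : z - y = ((`|x| - `|y|) / `|y|) *: y.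
  by rewrite mulrBl divff ?gt_eqF // scalerBl scale1r.
have zyN : `|z - y| = `| `|y| - `|x| |.
  by rewrite zyE normrZ normrM normfV normr_id divfK ?gt_eqF // distrC.
have py : p y <= M.
  by have := pD (y - x) x; rewrite subrK /M; lra.
have pzy : p (z - y) <= 1 / 2.
  rewrite zyE pZ normrM normfV normr_id distrC mulrAC ler_pdivrMr //.
  have := weak_seminorm_ge0 p y wp => py0.
  move: d3; rewrite ltr_pdivlMr; last by lra.
  have := normr_ge0 (`|y| - `|x|).
  nra.
have pzx : p (z - x) < 1.
  by have := pD (z - y) (y - x); rewrite addrA subrK; lra.
have := pK z zN pzx.
have := ler_normB (z - x) (z - y).
rewrite opprB addrC addrA subrK zyN; lra.
Qed.

End KadecNorm.

(** * Diameters *)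

Section Diameter.
Context {R : realType} {X : normedModType R}.

Lemma norm_diam_le (A : set X) (e : R) :
  (forall x y, A x -> A y -> `|x - y| <= e) -> (norm_diam A <= e%:E)%E.
Proof.
by move=> Ae; apply: ge_ereal_sup => _ [x Ax [y Ay <-]]; rewrite lee_fin Ae.
Qed.

Lemma norm_diam_ge0 (A : set X) : A !=set0 -> (0 <= norm_diam A)%E.
Proof.
by move=> [x Ax]; apply: ereal_sup_ubound; exists x => //; exists x => //;
  rewrite subrr normr0.
Qed.

Lemma cvg_norm_diam0 (A : nat -> set X) : (forall i, A i !=set0) ->
  (forall e : R, 0 < e -> \forall i \near \oo, (norm_diam (A i) <= e%:E)%E) ->
  norm_diam (A i) @[i --> \oo] --> 0%E.
Proof.
move=> A0 Ae; have fin (e : R) i : (norm_diam (A i) <= e%:E)%E ->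
    norm_diam (A i) \is a fin_num.
  by move=> h; rewrite ge0_fin_numE ?norm_diam_ge0 // (le_lt_trans h) // ltry.
apply/fine_cvgP; split.
  by apply: filterS (Ae 1 ltr01) => i; exact: fin.
apply/cvgrPdist_le => e e0; apply: filterS (Ae e e0) => i h /=.
rewrite sub0r normrN ger0_norm ?fine_ge0 ?norm_diam_ge0 //.
by rewrite -lee_fin fineK // (fin e).
Qed.

End Diameter.

(** * The strategy *)

Section Strategy.
Context {R : realType} {X : normedModType R}.
Implicit Types (A B C : set (weak_ball X)) (e : R).

(** Typed in X, so that norms and differences are those of X. *)
Definition ball_val (y : weak_ball X) : X := set_val y.

Definition diam A : \bar R := norm_diam (set_val @` A : set X).

(** The inequality says that the norms of the points of C are within e of the
    supremum of the norm on A. *)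
Definition slice e A C : Prop := nonempty_relopen A C /\
  forall y z, C y -> A z -> `|ball_val z| < `|ball_val y| + e.

(** Diameter minimal up to e among the slices: the infimum need not be
    attained. *)
Definition thin_slice e A B : Prop :=
  slice e A B /\ forall C, slice e A C -> (diam B <= diam C + e%:E)%E.

Lemma nonempty_relopenI A B (V : set (weak X)) (y : weak_ball X) :
  nonempty_relopen A B -> open V -> B y -> V (ball_val y) ->
  nonempty_relopen A (B `&` (set_val @^-1` V)).
Proof.
move=> [_ [U oU ->]] oV By Vy; split; first by exists y.
exists (U `&` (set_val @^-1` V)); last by rewrite setIA.
by apply: openI => //; exists V.
Qed.

Lemma ball_val_le1 (y : weak_ball X) : `|ball_val y| <= 1.
Proof. by have := set_valP y. Qed.

Lemma slice_exists (hX : kadec X) e A : 0 < e -> A !=set0 ->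
  exists C, slice e A C.
Proof.
move=> e0 [a Aa]; pose N := [set `|ball_val y| | y in A].
have supN : has_sup N.
  split; first by exists `|ball_val a|; exists a.
  by exists 1 => _ [y _ <-]; exact: ball_val_le1.
have [_ [y Ay <-] ysup] := sup_adherent e0 supN.
pose V : set (weak X) := [set z : X | sup N - e < `|z|].
have oV : open V.
  rewrite openE => z; exact: kadec_norm_lsc.
have AA : nonempty_relopen A A.
  by split; [exists a|exists setT; [exact: openT|rewrite setIT]].
exists (A `&` (set_val @^-1` V)); split.
  exact: (nonempty_relopenI A A V y AA oV Ay ysup).
move=> y1 z [_ Vy1] Az; rewrite -ltrBlDr.
apply: le_lt_trans Vy1; rewrite lerD2r.
by apply: sup_upper_bound => //; exists z.
Qed.

Lemma diam_ge0 A : A !=set0 -> (0 <= diam A)%E.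
Proof. by move=> [a Aa]; apply: norm_diam_ge0; exists (set_val a); exists a. Qed.

Lemma diam_le2 A : (diam A <= 2%:E)%E.
Proof.
apply: norm_diam_le => _ _ [x _ <-] [y _ <-].
apply: le_trans (ler_normB _ _) _.
have := ball_val_le1 x; have := ball_val_le1 y; rewrite /ball_val; lra.
Qed.

Lemma thin_slice_exists (hX : kadec X) e A : 0 < e -> A !=set0 ->
  exists B, thin_slice e A B.
Proof.
move=> e0 A0; pose D := [set diam C | C in slice e A].
have Dfin : ereal_inf D \is a fin_num.
  have [C sC] := slice_exists hX _ _ e0 A0.
  rewrite ge0_fin_numE.
    apply: (@le_lt_trans _ _ 2%:E); last exact: ltry.
    apply: le_trans (diam_le2 C).
    by apply: ereal_inf_lbound; exists C.
  by apply: le_ereal_inf_tmp => _ [C' [[C'0 _] _] <-]; exact: diam_ge0.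
have [_ [B sB <-] BD] := lb_ereal_inf_adherent e0 Dfin.
exists B; split => // C sC; apply: le_trans (ltW BD) _.
by rewrite leeD2r //; apply: ereal_inf_lbound; exists C.
Qed.

(** The weak neighbourhood V of x given by [kadec_shell] cuts B i in a slice of
    A i of small diameter, and B i is nearly as thin as any slice of A i. *)
Lemma thin_slice_diam (hX : kadec X) (A B : nat -> set (weak_ball X)) x :
  (forall i, thin_slice i.+1%:R^-1 (A i) (B i)) -> (forall i, B i x) ->
  forall e, 0 < e -> \forall i \near \oo, (diam (B i) <= e%:E)%E.
Proof.
move=> AB Bx e e0; have e30 : 0 < e / 3 by lra.
have [d d0] := kadec_shell hX (ball_val x) _ e30.
rewrite (@nbhsE (weak X)) => -[V [oV Vx] Vd].
have small (c : R) (c0 : 0 < c) : \forall i \near \oo, i.+1%:R^-1 < c.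
  exact: (near_infty_natSinv_lt (PosNum c0)).
near=> i.
have c_d : i.+1%:R^-1 < d by near: i; exact: small.
have c_e : i.+1%:R^-1 < e / 3 by near: i; exact: small.
have [[Bo Bn] Bmin] := AB i.
have BA : B i `<=` A i by have [_ [U _ ->]] := Bo => y [].
pose C := B i `&` (set_val @^-1` V).
have sC : slice i.+1%:R^-1 (A i) C.
  split; last by move=> y z [By _]; exact: Bn.
  exact: (nonempty_relopenI _ _ V x Bo oV (Bx i) Vx).
have Cx y : C y -> `|ball_val y - ball_val x| < e / 3.
  move=> [By Vy]; apply: (Vd (ball_val y) Vy).
  have := Bn _ _ By (BA _ (Bx i)); have := Bn _ _ (Bx i) (BA _ By).
  move: (i.+1%:R^-1) c_d => c cd xy yx.
  by rewrite ltr_norml; apply/andP; split; lra.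
have dC : (diam C <= (2 * (e / 3))%:E)%E.
  apply: norm_diam_le => _ _ [y Cy <-] [z Cz <-].
  apply: le_trans (ler_distD (ball_val x) _ _) _.
  have := Cx _ Cy; have := Cx _ Cz; rewrite (distrC (ball_val x)) /ball_val.
  by lra.
apply: le_trans (Bmin _ sC) _.
apply: (@le_trans _ _ ((2 * (e / 3))%:E + i.+1%:R^-1%:E)%E).
  by rewrite leeD2r.
by rewrite -EFinD lee_fin; move: (i.+1%:R^-1) c_e => c ce; lra.
Unshelve. all: by end_near. Qed.

(** The length of the history h is the index of the move, which makes the
    tolerance tend to 0 along a play. *)
Definition thin_strategy : strategy_map (weak_ball X) :=
  fun h A => xget set0 (thin_slice (size h).+1%:R^-1 A).

Lemma thin_strategyP (hX : kadec X) h A : A !=set0 ->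
  thin_slice (size h).+1%:R^-1 A (thin_strategy h A).
Proof. by move=> A0; apply: xgetPex; apply: thin_slice_exists. Qed.

End Strategy.

Theorem theorem2p1 (R : realType) (X : completeNormedModType R) (hX : kadec X) :
  exists s : strategy_map (weak_ball X),
    is_strategy s /\
    forall A B : nat -> set (weak_ball X), is_s_play s A B ->
      \bigcap_i B i = set0 \/
      norm_diam (set_val @` B i : set X) @[i --> \oo] --> 0%E.
Proof.
exists thin_strategy; split.
  move=> h A dom; have A0 : A !=set0 by case: dom.
  by have [[]] := thin_strategyP hX h A A0.
move=> A B [[A0 _ _] Bs].
have thinB i : thin_slice i.+1%:R^-1 (A i) (B i).
  have := thin_strategyP hX (mkseq (fun j => (A j, B j)) i) _ (A0 i).
  by rewrite size_mkseq -Bs.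
have [[x Bx]|B0] := pselect (\bigcap_i B i !=set0); last first.
  by left; apply/eqP/negPn/negP => /set0P.
right; apply: cvg_norm_diam0.
  by move=> i; exists (set_val x), x => //; exact: Bx.
by apply: (thin_slice_diam hX A _ x) => // i; exact: Bx.
Qed.
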